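(* Let $m,N\ge 1$ be integers and let $\mathcal{F}=(\mathbb{R}^{m};f_{1},f_{2},\dots,f_{N})$ be an affine iterated function system, i.e. each $f_n:\mathbb{R}^m\to\mathbb{R}^m$ is an affine map. If $\mathcal{F}$ has a coding map $\pi:\Omega\to\mathbb{R}^{m}$, then $\mathcal{F}$ is hyperbolic on the affine hull of $\pi(\Omega)$. In particular, if $\pi(\Omega)$ contains a non-empty open subset of $\mathbb{R}^{m}$, then $\mathcal{F}$ is hyperbolic on $\mathbb{R}^{m}$.
   Context: $\Omega=\{1,\dots,N\}^{\infty}$ is the set of infinite sequences $\sigma=\sigma_1\sigma_2\sigma_3\cdots$, with the product topology. A coding map for $\mathcal{F}$ is a continuous map $\pi:\Omega\to\mathbb{R}^m$ such that $f_n(\pi(\sigma))=\pi(n\sigma)$ for all $n\in\{1,\dots,N\}$ and $\sigma\in\Omega$, where $n\sigma$ denotes the sequence $n\sigma_1\sigma_2\cdots$. The affine hull of a set $B\subseteq\mathbb{R}^m$ is the smallest affine subspace containing $B$. Let $d_E$ be the Euclidean metric. For an affine subspace $E\subseteq\mathbb{R}^m$, $\mathcal{F}$ is hyperbolic on $E$ if $f_n(E)\subseteq E$ for all $n$ and there is a metric $d$ on $E$, Lipschitz equivalent to the restriction of $d_E$ (i.e. there are constants $r,R>0$ with $r\,d_E(x,y)\le d(x,y)\le R\,d_E(x,y)$ for all $x,y\in E$), such that each $f_n|_E$ is a contraction with respect to $d$ (i.e. there is $\alpha_n\in[0,1)$ with $d(f_n(x),f_n(y))\le\alpha_n d(x,y)$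 for all $x,y\in E$). *)

(* Defs.v *)
From HB Require Import structures.
From mathcomp Require Import all_boot all_order all_algebra.
From mathcomp Require Import all_classical all_reals all_analysis.
Import Order.TTheory GRing.Theory Num.Theory.
Import numFieldNormedType.Exports.

Set Implicit Arguments.
Unset Strict Implicit.
Unset Printing Implicit Defensive.

Local Open Scope classical_set_scope.
Local Open Scope ring_scope.

(* 'I_N, i.e. {0, ..., N-1}, plays the role of {1, ..., N}. *)
Definition code_space (N : nat) :=
  prod_topology (fun _ : nat => discrete_topology 'I_N).

HB.instance Definition _ (N : nat) := Topological.copy (code_space N)
  (prod_topology (fun _ : nat => discrete_topology 'I_N)).

Definition code_cons (N : nat) (n : 'I_N) (s : code_space N) : code_space N :=
  fun k => if k is k'.+1 then s k' else n.

Definition affine_map (R : realType) (m : nat)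
    (g : 'rV[R]_m -> 'rV[R]_m) : Prop :=
  exists (L : {linear 'rV[R]_m -> 'rV[R]_m}) (b : 'rV[R]_m),
    forall x, g x = L x + b.

Definition coding_map (R : realType) (m N : nat)
    (f : 'I_N -> 'rV[R]_m -> 'rV[R]_m) (pi : code_space N -> 'rV[R]_m) : Prop :=
  continuous pi /\ forall n s, f n (pi s) = pi (code_cons n s).

Definition affine_subspace (R : realType) (m : nat)
    (E : set 'rV[R]_m) : Prop :=
  exists (p : 'rV[R]_m) (V : {vspace 'rV[R]_m}), E = [set x | x - p \in V].

(* The empty set is not an [affine_subspace]; the intersection below is the
   least affine subspace containing B when B is nonempty, see
   [affine_hullP]. *)
Definition affine_hull (R : realType) (m : nat)
    (B : set 'rV[R]_m) : set 'rV[R]_m :=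
  smallest (@affine_subspace R m) B.

(* The norm of 'rV[R]_m in the library is the sup norm, hence this explicit
   Euclidean distance. *)
Definition euclidean_dist (R : realType) (m : nat) (x y : 'rV[R]_m) : R :=
  Num.sqrt (\sum_(i < m) (x ord0 i - y ord0 i) ^+ 2).

(* A metric on the subset E is represented by a function on the whole space
   whose values outside of E x E are irrelevant. *)
Definition metric_on (R : realType) (T : Type) (E : set T)
    (d : T -> T -> R) : Prop :=
  [/\ forall x y, E x -> E y -> 0 <= d x y,
      forall x y, E x -> E y -> (d x y = 0 <-> x = y),
      forall x y, E x -> E y -> d x y = d y x
    & forall x y z, E x -> E y -> E z -> d x z <= d x y + d y z].

Definition lipschitz_equivalent_on (R : realType) (T : Type) (E : set T)
    (d d' : T -> T -> R) : Prop :=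
  exists r1 r2 : R, [/\ 0 < r1, 0 < r2 &
    forall x y, E x -> E y -> r1 * d' x y <= d x y <= r2 * d' x y].

Definition contraction_on (R : realType) (T : Type) (E : set T)
    (d : T -> T -> R) (g : T -> T) : Prop :=
  exists alpha : R, 0 <= alpha < 1 /\
    forall x y, E x -> E y -> d (g x) (g y) <= alpha * d x y.

(* To be used for an affine subspace E. *)
Definition hyperbolic_on (R : realType) (m N : nat)
    (f : 'I_N -> 'rV[R]_m -> 'rV[R]_m) (E : set 'rV[R]_m) : Prop :=
  (forall n, f n @` E `<=` E) /\
  exists d : 'rV[R]_m -> 'rV[R]_m -> R,
    [/\ metric_on E d,
        lipschitz_equivalent_on E d (@euclidean_dist R m)
      & forall n, contraction_on E d (f n)].

Lemma affine_hullP (R : realType) (m : nat) (B : set 'rV[R]_m) :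
  B !=set0 ->
  [/\ affine_subspace (affine_hull B), B `<=` affine_hull B
    & forall E, affine_subspace E -> B `<=` E -> affine_hull B `<=` E].
Proof.
move=> [p Bp]; split; last 2 first.
- exact: sub_gen_smallest.
- by move=> E aE BE; exact: smallest_sub.
pose P (V : {vspace 'rV[R]_m}) := B `<=` [set x | x - p \in V].
have exk : exists k, `[< exists2 V, P V & \dim V = k >].
  exists (\dim (fullv : {vspace 'rV[R]_m})); apply/asboolP.
  by exists fullv => // x _ /=; exact: memvf.
case: (ex_minnP exk) => k /asboolP[V PV dV] kmin.
exists p, V; apply/seteqP; split.
  apply: smallest_sub => //; by exists p, V.
move=> x /= xV A [[q [W ->]] BA] /=.
have pW : p - q \in W by exact: (BA p Bp).
have PI : P (V :&: W)%VS.
  move=> y By /=; rewrite memv_cap; apply/andP; split; first exact: PV.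
  by have := rpredB (BA y By : y - q \in W) pW; rewrite opprB addrA subrK.
have /eqP VWE : (V :&: W == V)%VS.
  rewrite eqEdim capvSl /= dV; apply: kmin; apply/asboolP.
  by exists (V :&: W)%VS.
have xW : x - p \in W by move: xV; rewrite -VWE memv_cap => /andP[].
by have := rpredD xW pW; rewrite addrA subrK.
Qed.

(* Main.v *)
Require Import Defs.
From mathcomp Require Import all_boot all_order all_algebra.
From mathcomp Require Import all_classical all_reals all_analysis.
From mathcomp Require Import lra.
Import Order.TTheory GRing.Theory Num.Theory.
Import numFieldNormedType.Exports.

Local Open Scope classical_set_scope.
Local Open Scope ring_scope.

(** Write f_n(x) = L_n x + b_n, and let W be the direction of the affine hull
    of K = pi(Omega), that is, the span of the differences pi(s) - pi(t). Only
    the linear maps L_n restricted to W matter for the distances between points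
    of the hull.

    For a word w of length k, L_w (pi(s) - pi(t)) = pi(w s) - pi(w t). The
    sequences w s and w t agree on their first k entries, and pi is uniformly
    continuous because the code space is compact
    ([code_space_unif_continuous]); hence these vectors are uniformly small,
    over all s, t and all words w of length k, when k is large
    ([word_norm_coding]). Finitely many differences span W
    ([span_finite_subset]), so smallness on them gives a bound on the operator
    norm ([seminorm_span_bound]): for some k, every product of k of the L_n at
    least halves the norm of every vector of W.

    From this a norm contracted by every single L_n is obtained by summing the
    maximal sizes of v after 0, 1, ..., k - 1 steps ([adapted_norm]): applying
    L_n shifts the sum by one place, which loses the term |v| and gains a term
    at most |v| / 2, and |v| is a fixed proportion of the whole sum. The
    distance it defines on the hull is the required metric.

    If K contains a nonempty open set, its affine hull is the whole space
    ([affine_hull_open]). *)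

(** * Cylinders and uniform continuity on the code space *)

Definition agree_upto {N : nat} (k : nat) (s t : code_space N) : Prop :=
  forall i, (i < k)%N -> s i = t i.

Lemma code_space_compact (N : nat) : compact [set: code_space N].
Proof.
have := @tychonoff nat (fun=> discrete_topology 'I_N) (fun=> setT)
  (fun=> @finite_compact (discrete_topology 'I_N) setT finite_finset).
by congr compact; apply/seteqP; split.
Qed.

Lemma nbhs_cylinder {N : nat} (s : code_space N) (k : nat) :
  nbhs s (agree_upto k s).
Proof.
elim: k => [|k IHk]; first by apply: filterS filterT => t _ i.
have sk : nbhs s [set t : code_space N | t k = s k].
  exact: (@proj_continuous nat (fun=> discrete_topology 'I_N) k s
    [set s k] (discrete_set1 (s k : discrete_topology 'I_N))).
apply: filterS2 IHk sk => t st tk i; rewrite ltnS leq_eqVlt => /orP[/eqP->|].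
  by rewrite tk.
exact: st.
Qed.

(** The cylinders around s generate a filter all of whose projections converge
    to those of s, so it converges to s in the product topology. *)
Lemma cylinder_basis {N : nat} (s : code_space N) (A : set (code_space N)) :
  nbhs s A -> exists k, agree_upto k s `<=` A.
Proof.
pose F : set_system (code_space N) :=
  filter_from setT (fun k => agree_upto k s).
have FF : Filter F.
  apply: filter_fromT_filter; first by exists 0%N.
  move=> i j; exists (maxn i j) => t st.
  by split=> l lt_l; apply: st; rewrite leq_max lt_l ?orbT.
suff Fs : F --> s by move=> /Fs[k _ kA]; exists k.
apply/cvg_sup => i B [C [[D oD <-] Ds DB]].
exists i.+1 => // t st; apply: DB; rewrite /= -(st i) //.
Qed.

(** This is the Heine-Cantor theorem. Two points of a cylinder around s have the
    same cylinders as s up to its length, so the length that works at s works at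
    every point of a neighborhood of s; compactness makes it uniform. *)
Lemma code_space_unif_continuous {R : realType} {m N : nat}
    (pi : code_space N -> 'rV[R]_m) (e : R) : continuous pi -> 0 < e ->
  exists k, forall s t, agree_upto k s t -> `|pi s - pi t| <= e.
Proof.
move=> pi_cont e_gt0.
have /compact_near_coveringP/(_ nat \oo) := code_space_compact N.
pose P k s := forall t, agree_upto k s t -> `|pi s - pi t| <= e.
move=> /(_ P _)[s _|k _ kP]; last first.
  by exists k => s t; apply: (kP k) => /=.
have e2_gt0 : 0 < e / 2 by lra.
have /cvgrPdist_lt/(_ _ e2_gt0)/cylinder_basis[k kP] := pi_cont s.
exists (agree_upto k s, [set l | (k <= l)%N]).
  by split; [exact: nbhs_cylinder | exists k].
move=> [t l] /= [st kl] u tu.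
have su : agree_upto k s u by move=> i ik; rewrite st // tu // (leq_trans ik).
have := ler_normB (pi s - pi u) (pi s - pi t).
rewrite opprB addrC subrKA.
by have := kP _ st; have := kP _ su; rewrite /=; lra.
Qed.

(** * Seminorms on row vectors *)

Definition seminorm {R : realType} {V : lmodType R} (q : V -> R) : Prop :=
  (forall u v, q (u + v) <= q u + q v) /\
  (forall a v, q (a *: v) = `|a| * q v).

Lemma seminorm0 {R : realType} {V : lmodType R} (q : V -> R) :
  seminorm q -> q 0 = 0.
Proof. by case=> _ qZ; rewrite -(scale0r 0) qZ normr0 mul0r. Qed.

Lemma seminormN {R : realType} {V : lmodType R} (q : V -> R) v :
  seminorm q -> q (- v) = q v.
Proof. by case=> _ qZ; rewrite -scaleN1r qZ normrN1 mul1r. Qed.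

Lemma seminorm_ge0 {R : realType} {V : lmodType R} (q : V -> R) v :
  seminorm q -> 0 <= q v.
Proof.
move=> sq; have := sq.1 v (- v).
by rewrite subrr seminorm0 // seminormN //; lra.
Qed.

Lemma seminorm_sum {R : realType} {V : lmodType R} (q : V -> R) (I : finType)
    (F : I -> V) : seminorm q -> q (\sum_i F i) <= \sum_i q (F i).
Proof.
move=> sq; elim/big_ind2: _ => //; first by rewrite seminorm0.
by move=> x a y b xa yb; rewrite (le_trans (sq.1 _ _)) // lerD.
Qed.

Lemma sum_seminorm {R : realType} {V : lmodType R} (I : finType)
    (q : I -> V -> R) :
  (forall i, seminorm (q i)) -> seminorm (fun v => \sum_i q i v).
Proof.
move=> sq; split=> [u v|a v].
  by rewrite -big_split ler_sum // => i _; exact: (sq i).1.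
by rewrite mulr_sumr; apply: eq_bigr => i _; exact: (sq i).2.
Qed.

Lemma coord_le_norm {R : realType} {m : nat} (v : 'rV[R]_m) (i : 'I_m) :
  `|v ord0 i| <= `|v|.
Proof. by rewrite [leRHS]mx_normrE (le_bigmax _ _ (ord0, i)). Qed.

Lemma seminorm_bounded {R : realType} {m : nat} (q : 'rV[R]_m -> R) :
  seminorm q -> exists2 C, 0 <= C & forall v, q v <= C * `|v|.
Proof.
move=> sq; exists (\sum_(i < m) q 'e_i).
  by apply: sumr_ge0 => i _; exact: seminorm_ge0.
move=> v; rewrite {1}(row_sum_delta v) (le_trans (seminorm_sum _ _ _ sq)) //.
rewrite mulr_suml ler_sum // => i _.
by rewrite sq.2 mulrC ler_wpM2l ?seminorm_ge0 ?coord_le_norm.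
Qed.

(** A seminorm is controlled by its values on a spanning family, through the
    coordinates in that family. The family may be linearly dependent, as
    [coord] still provides coordinates that depend linearly on the vector. What
    matters is that C does not depend on q: the smallness e required on X can
    be computed from C before q is chosen. *)
Lemma seminorm_span_bound {R : realType} {m : nat} (X : seq 'rV[R]_m) :
  exists2 C, 0 < C & forall (q : 'rV[R]_m -> R) (e : R), seminorm q -> 0 <= e ->
    (forall x, x \in X -> q x <= e) ->
    forall v, v \in <<X>>%VS -> q v <= C * e * `|v|.
Proof.
pose c (v : 'rV[R]_m) := \sum_(i < size X) `|coord (in_tuple X) i v|.
have [C C_ge0 cC] : exists2 C, 0 <= C & forall v, c v <= C * `|v|.
  apply: seminorm_bounded; apply: sum_seminorm => i; split=> [u v|a v].
    by rewrite linearD ler_normD.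
  by rewrite linearZ normrM.
exists (C + 1) => [|q e sq e_ge0 qX v vX]; first by lra.
rewrite {1}(@coord_span _ _ _ (in_tuple X) v vX).
rewrite (le_trans (seminorm_sum _ _ _ sq)) //.
apply: (@le_trans _ _ (c v * e)); last first.
  rewrite mulrAC ler_wpM2r // (le_trans (cC v)) // ler_wpM2r //.
  by lra.
rewrite mulr_suml ler_sum // => i _.
by rewrite sq.2 ler_wpM2l // qX // mem_nth.
Qed.

(** Take a finite subset of D whose span has the largest dimension. *)
Lemma span_finite_subset {R : realType} {m : nat} (D : set 'rV[R]_m) :
  exists2 X : seq 'rV[R]_m,
    forall x, x \in X -> D x & forall x, D x -> x \in <<X>>%VS.
Proof.
pose P (d : nat) := `[< exists2 X : seq 'rV[R]_m,
  forall x, x \in X -> D x & \dim <<X>> = d >].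
have exP : exists d, P d by eexists; apply/asboolP; exists [::].
have ubP d : P d -> (d <= \dim {:'rV[R]_m})%N.
  by move=> /asboolP[X _ <-]; rewrite dimvS ?subvf.
case: (ex_maxnP exP ubP) => d /asboolP[X XD dX] dmax.
exists X => // x Dx.
have sX : (<<X>> <= <<x :: X>>)%VS by rewrite span_cons addvSr.
suff /eqP-> : (<<X>> == <<x :: X>>)%VS by rewrite memv_span ?mem_head.
rewrite eqEdim sX dX dmax //; apply/asboolP; exists (x :: X) => // y.
by rewrite inE => /predU1P[->|/XD].
Qed.

(** * The adapted norm *)

(** The maximum of |L_w v| over the words w of length j. *)
Fixpoint word_norm {R : realType} {m N : nat}
    (L : 'I_N -> {linear 'rV[R]_m -> 'rV[R]_m}) (j : nat) (v : 'rV[R]_m) : R :=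
  if j is j'.+1 then \big[Num.max/0]_(n < N) word_norm L j' (L n v) else `|v|.

Lemma seminorm_word_norm {R : realType} {m N : nat}
    (L : 'I_N -> {linear 'rV[R]_m -> 'rV[R]_m}) (j : nat) :
  seminorm (word_norm L j).
Proof.
elim: j => [|j IHj]; split=> [u v|a v] /=.
- exact: ler_normD.
- exact: normrZ.
- apply: bigmax_le => [|n _].
    by rewrite addr_ge0 ?bigmax_ge_id.
  rewrite linearD (le_trans (IHj.1 _ _)) // lerD //.
    exact: (le_bigmax _ (fun n => word_norm L j (L n u))).
  exact: (le_bigmax _ (fun n => word_norm L j (L n v))).
- rewrite (@big_morph _ _ (fun x => `|a| * x) 0 Num.max) ?mulr0 //.
    by apply: eq_bigr => n _; rewrite linearZ IHj.2.
  by move=> x y; rewrite maxr_pMr.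
Qed.

Lemma word_norm_step {R : realType} {m N : nat}
    (L : 'I_N -> {linear 'rV[R]_m -> 'rV[R]_m}) (j : nat) n v :
  word_norm L j (L n v) <= word_norm L j.+1 v.
Proof. exact: (le_bigmax _ (fun n => word_norm L j (L n v))). Qed.

(** Each L_n maps pi(s) - pi(t) to pi(n s) - pi(n t), and prepending n makes the
    two codes agree on one more entry. The induction on j thus has to range over
    all lengths i of agreement; i = 0 is the case of arbitrary s and t. *)
Lemma word_norm_coding {R : realType} {m N : nat}
    (f : 'I_N -> 'rV[R]_m -> 'rV[R]_m)
    (L : 'I_N -> {linear 'rV[R]_m -> 'rV[R]_m})
    (pi : code_space N -> 'rV[R]_m) (k : nat) (e : R) :
  (forall n x y, f n x - f n y = L n (x - y)) ->
  (forall n s, f n (pi s) = pi (code_cons n s)) ->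
  0 <= e ->
  (forall s t, agree_upto k s t -> `|pi s - pi t| <= e) ->
  forall j i s t, (k <= i + j)%N -> agree_upto i s t ->
    word_norm L j (pi s - pi t) <= e.
Proof.
move=> fL fpi e_ge0 pie; elim=> [|j IHj] i s t /= kij st.
  by apply: pie => l lk; apply: st; rewrite addn0 in kij; exact: leq_trans kij.
apply: bigmax_le => // n _; rewrite -fL !fpi; apply: (IHj i.+1).
  by rewrite addSnnS.
by case=> [|l] //= li; exact: st.
Qed.

(** If all products of k + 1 maps halve the norm on W, the norm
    q v = word_norm 0 v + ... + word_norm k v is contracted by each map on W:
    q (L n v) <= q v - |v| + |v| / 2, and |v| >= q v / C. Summing these terms,
    rather than taking a maximum with geometric weights, avoids extracting a
    (k + 1)-st root of 1 / 2. *)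
Lemma adapted_norm {R : realType} {m N : nat}
    (L : 'I_N -> {linear 'rV[R]_m -> 'rV[R]_m}) (W : {vspace 'rV[R]_m})
    (k : nat) :
  (forall v, v \in W -> word_norm L k.+1 v <= `|v| / 2) ->
  exists q : 'rV[R]_m -> R, exists C a : R,
    [/\ seminorm q, 0 < C, forall v, `|v| <= q v <= C * `|v|, 0 <= a < 1
      & forall n v, v \in W -> q (L n v) <= a * q v].
Proof.
move=> Lk; pose q v := \sum_(j < k.+1) word_norm L j v.
have sq : seminorm q.
  apply: (sum_seminorm _ (fun j : 'I_k.+1 => word_norm L j)) => j.
  exact: seminorm_word_norm.
have [C0 C0_ge0 qC0] := @seminorm_bounded R m q sq.
have C_gt0 : 0 < C0 + 1 by lra.
have qC v : q v <= (C0 + 1) * `|v|.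
  by rewrite (le_trans (qC0 v)) // ler_wpM2r // lerDl.
exists q, (C0 + 1), (1 - ((C0 + 1) * 2)^-1); split=> //.
- move=> v; rewrite qC andbT /q big_ord_recl /= lerDl.
  apply: sumr_ge0 => j _.
  exact: (seminorm_ge0 _ _ (seminorm_word_norm L j.+1)).
- have : 0 < ((C0 + 1) * 2)^-1 by rewrite invr_gt0; lra.
  have : ((C0 + 1) * 2)^-1 <= 1 by rewrite invf_le1; lra.
  by move=> ? ?; apply/andP; split; lra.
move=> n v vW.
have shift : q (L n v) + `|v| <= q v + `|v| / 2.
  apply: (@le_trans _ _ (\sum_(j < k.+2) word_norm L j v)).
    (* The term of index 0 of the sum is |v|. *)
    rewrite big_ord_recl addrC lerD2l ler_sum // => j _.
    exact: word_norm_step.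
  by rewrite big_ord_recr lerD2l; exact: Lk.
have : ((C0 + 1) * 2)^-1 * q v <= `|v| / 2.
  by rewrite invfM mulrAC ler_wpM2r // mulrC ler_pdivrMr // mulrC.
by rewrite mulrBl mul1r; lra.
Qed.

(** * Affine hulls *)

(** The right-hand side contains B by the last hypothesis, and any affine
    subspace containing B has a direction that contains the differences in X. *)
Lemma affine_hull_span {R : realType} {m : nat} (B : set 'rV[R]_m)
    (p : 'rV[R]_m) (X : seq 'rV[R]_m) :
  B p -> (forall x, x \in X -> exists b c, [/\ B b, B c & x = b - c]) ->
  (forall b, B b -> b - p \in <<X>>%VS) ->
  affine_hull B = [set x | x - p \in <<X>>%VS].
Proof.
move=> Bp XB BX.
have [[q [V hullE]] subhull minhull] := affine_hullP (ex_intro _ p Bp).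
have BV b : B b -> b - q \in V by move=> /subhull; rewrite hullE.
apply/seteqP; split; first by apply: minhull => //; exists p, <<X>>%VS.
have /span_subvP XV : forall x, x \in X -> x \in V.
  move=> _ /XB[b [c [Bb Bc ->]]].
  by rewrite -(subrKA q) -[q - c]opprB rpredB ?BV.
move=> x /= /(subvP XV) xpV; rewrite hullE /=.
by rewrite -(subrKA p) rpredD ?BV.
Qed.

(** From a point u of U one can move a little towards any x and stay in U, so
    x - u lies in the direction of the hull. *)
Lemma affine_hull_open {R : realType} {m : nat} (B U : set 'rV[R]_m) :
  open U -> U !=set0 -> U `<=` B -> affine_hull B = setT.
Proof.
move=> oU [u Uu] UB.
have [[q [V hullE]] subhull _] := affine_hullP (ex_intro _ u (UB u Uu)).
have UV b : U b -> b - q \in V by move=> /UB/subhull; rewrite hullE.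
apply/seteqP; split=> // x _; rewrite hullE /=.
have /nbhs_ballP[e /= e_gt0 eU] := open_nbhs_nbhs (conj oU Uu).
have den_gt0 : 0 < `|x - u| + 1 by have := normr_ge0 (x - u); lra.
pose t := e / (`|x - u| + 1) / 2.
have t_gt0 : 0 < t by rewrite !divr_gt0.
have /eU/UV tV : ball u e (u + t *: (x - u)).
  rewrite -ball_normE /= opprD addrA subrr sub0r normrN normrZ gtr0_norm //.
  have : t * (`|x - u| + 1) = e / 2 by rewrite /t mulrAC divfK ?gt_eqF.
  rewrite mulrDr mulr1 => tE.
  by clear - tE t_gt0 e_gt0; lra.
have : t *: (x - u) \in V.
  by have := rpredB tV (UV u Uu); rewrite opprB subrKA addrAC subrr add0r.
rewrite rpredZeq (gt_eqF t_gt0) /= => xuV.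
by rewrite -(subrKA u) rpredD ?UV.
Qed.

(** * Hyperbolicity *)

Lemma euclidean_dist_equiv {R : realType} (m : nat) :
  exists2 K, 0 < K & forall x y : 'rV[R]_m,
    `|x - y| <= euclidean_dist x y <= K * `|x - y|.
Proof.
exists (Num.sqrt m%:R + 1); first by have := @sqrtr_ge0 R m%:R; lra.
move=> x y.
have coordE i : x ord0 i - y ord0 i = (x - y) ord0 i by rewrite !mxE.
apply/andP; split.
  rewrite [leLHS]mx_normrE; apply: bigmax_le => [|[j i] _ /=].
    exact: sqrtr_ge0.
  rewrite (ord1 j) -coordE -sqrtr_sqr ler_wsqrtr // (bigD1 i) //= lerDl.
  by apply: sumr_ge0 => l _; exact: sqr_ge0.
apply: (@le_trans _ _ (Num.sqrt m%:R * `|x - y|)); last first.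
  by rewrite ler_wpM2r // lerDl.
rewrite -[X in _ * X]ger0_norm // -sqrtr_sqr -sqrtrM // ler_wsqrtr //.
apply: (@le_trans _ _ (\sum_(i < m) `|x - y| ^+ 2)); last first.
  by rewrite sumr_const card_ord mulr_natl.
apply: ler_sum => i _; rewrite coordE -real_normK ?num_real //.
by rewrite lerXn2r ?nnegrE ?coord_le_norm.
Qed.

Lemma hyperbolic_of_norm {R : realType} {m N : nat}
    (f : 'I_N -> 'rV[R]_m -> 'rV[R]_m) (E : set 'rV[R]_m)
    (q : 'rV[R]_m -> R) (C a : R) :
  seminorm q -> 0 < C -> (forall v, `|v| <= q v <= C * `|v|) -> 0 <= a < 1 ->
  (forall n, f n @` E `<=` E) ->
  (forall n x y, E x -> E y -> q (f n x - f n y) <= a * q (x - y)) ->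
  hyperbolic_on f E.
Proof.
move=> sq C_gt0 qC a01 fE fq; split=> //; exists (fun x y => q (x - y)); split.
- split=> [x y _ _|x y _ _|x y _ _|x y z _ _ _].
  + exact: seminorm_ge0.
  + split=> [q0|->]; last by rewrite subrr seminorm0.
    have /andP[+ _] := qC (x - y).
    by rewrite q0 normr_le0 subr_eq0 => /eqP.
  + by rewrite -seminormN // opprB.
  + by rewrite -(subrKA y) sq.1.
- have [K K_gt0 dK] := @euclidean_dist_equiv R m.
  exists K^-1, C; split=> [||x y _ _]; rewrite ?invr_gt0 //.
  have /andP[qge qle] := qC (x - y); have /andP[dge dle] := dK x y.
  apply/andP; split.
    by rewrite (le_trans _ qge) // mulrC ler_pdivrMr // mulrC.
  by rewrite (le_trans qle) // ler_wpM2l // ltW.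
by move=> n; exists a; split=> // x y Ex Ey; exact: fq.
Qed.

(** The sequence s0 only witnesses that the code space is nonempty; its image
    serves as the base point of the hull. *)
Lemma coding_map_hyperbolic {R : realType} {m N : nat} (s0 : code_space N)
    (f : 'I_N -> 'rV[R]_m -> 'rV[R]_m) (pi : code_space N -> 'rV[R]_m) :
  (forall n, affine_map (f n)) -> coding_map f pi ->
  hyperbolic_on f (affine_hull (range pi)).
Proof.
move=> affine_f [pi_cont fpi].
have /choice[L fL] : forall n, exists L : {linear 'rV[R]_m -> 'rV[R]_m},
    forall x y, f n x - f n y = L (x - y).
  move=> n; have [L [b fE]] := affine_f n; exists L => x y.
  by rewrite !fE linearB opprD addrACA subrr addr0.
have [X XD DX] := span_finite_subset
  [set v | exists s t, v = pi s - pi t].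
have [c c_gt0 spanX] := seminorm_span_bound X.
have e_gt0 : 0 < (c * 2)^-1 by rewrite invr_gt0 mulr_gt0.
have [k pik] := code_space_unif_continuous pi _ pi_cont e_gt0.
have norm_le v : v \in <<X>>%VS -> word_norm L k.+1 v <= `|v| / 2.
  move=> vX.
  (* The bound (2 c)^-1 on the spanning differences turns into 1 / 2 on W. *)
  have -> : `|v| / 2 = c * (c * 2)^-1 * `|v|.
    by rewrite invfM mulVKf ?gt_eqF // mulrC.
  apply: spanX => //; [exact: seminorm_word_norm|exact: ltW|].
  move=> x /XD[s [t ->]].
  apply: (word_norm_coding f L pi k (c * 2)^-1 _ _ _ _ k.+1 0%N) => //.
  exact: ltW.
have [q [C [a [sq C_gt0 qC a01 qL]]]] := adapted_norm L <<X>>%VS k norm_le.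
have hullE : affine_hull (range pi) = [set x | x - pi s0 \in <<X>>%VS].
  apply: affine_hull_span.
  - by exists s0.
  - by move=> x /XD[s [t ->]]; exists (pi s), (pi t).
  - by move=> _ [s _ <-]; apply: DX; exists s, s0.
have LX n v : v \in <<X>>%VS -> L n v \in <<X>>%VS.
  move=> vX; rewrite (@coord_span _ _ _ (in_tuple X) v vX) linear_sum.
  apply: rpred_sum => i _; rewrite linearZ rpredZ //; apply: DX => /=.
  have /XD[s [t ->]] : X`_i \in X by rewrite mem_nth.
  by exists (code_cons n s), (code_cons n t); rewrite -fL !fpi.
rewrite hullE; apply: (hyperbolic_of_norm _ _ q C a) => //.
  move=> n _ [x /= xX <-]; rewrite -(subrKA (f n (pi s0))) fL rpredD ?LX //.
  by apply: DX; exists (code_cons n s0), s0; rewrite fpi.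
move=> n x y /= xX yX; rewrite fL; apply: qL.
by rewrite -(subrKA (pi s0)) -[pi s0 - y]opprB rpredB.
Qed.

Theorem theorem1p2 (R : realType) (m N : nat) (hm : (0 < m)%N) (hN : (0 < N)%N)
    (f : 'I_N -> 'rV[R]_m -> 'rV[R]_m) (hf : forall n, affine_map (f n))
    (pi : code_space N -> 'rV[R]_m) (hpi : coding_map f pi) :
  hyperbolic_on f (affine_hull (range pi)) /\
  ((exists U : set 'rV[R]_m, [/\ open U, U !=set0 & U `<=` range pi]) ->
   hyperbolic_on f setT).
Proof.
have hyp := coding_map_hyperbolic (fun=> Ordinal hN) f pi hf hpi.
by split=> // -[U [oU U0 Upi]]; rewrite -(affine_hull_open (range pi) U).
Qed.
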